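(* Let $D$ be a dendriform algebra of codimension $1$ in the vector space $E$. Suppose that $V$ is a space complement of $D$ in $E$ with basis $\{x\}$. Then there exists a bijection $$\Phi:\mathcal{F}(D)\to\mathcal{O}(D,V),\qquad (l_1,l_2,r_1,r_2,p_1,p_2,q_1,q_2,a_1,a_2,\bar k_1,\bar k_2)\mapsto\Omega(D,V),$$ where the dendriform extending structure $\Omega(D,V)=(\triangleright_1,\triangleright_2,\triangleleft_1,\triangleleft_2,\rightharpoonup_1,\rightharpoonup_2,\leftharpoonup_1,\leftharpoonup_2,f_1,f_2,\succ_V,\prec_V)$ is defined, for $a\in D$ and $i=1,2$, by $$a\triangleright_i x=l_i(a)x,\quad x\triangleleft_i a=r_i(a)x,\quad x\rightharpoonup_i a=p_i(a),\quad a\leftharpoonup_i x=q_i(a),\quad f_i(x,x)=a_i,$$ $$x\succ_V x=\bar k_1x,\qquad x\prec_V x=\bar k_2x.$$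
   Context: The base field is $\mathbf{k}=\mathbb{C}$. A dendriform algebra is a vector space $D$ with bilinear operations $\succ,\prec$ such that for all $x,y,z$: $(x\succ y+x\prec y)\succ z=x\succ(y\succ z)$; $(x\prec y)\prec z=x\prec(y\succ z+y\prec z)$; $(x\succ y)\prec z=x\succ(y\prec z)$. Write $\star:=\succ+\prec$. A space complement of a subspace $D$ in $E$ is a subspace $V$ with $E=D+V$ and $D\cap V=\{0\}$. An extending datum of $D$ through $V$ is a system of twelve bilinear maps $\Omega(D,V)=(\triangleright_1,\triangleright_2,\triangleleft_1,\triangleleft_2,\rightharpoonup_1,\rightharpoonup_2,\leftharpoonup_1,\leftharpoonup_2,f_1,f_2,\succ_V,\prec_V)$ with $\triangleright_i:D\times V\to V$, $\triangleleft_i:V\times D\to V$, $\rightharpoonup_i:V\times D\to D$, $\leftharpoonup_i:D\times V\to D$, $f_i:V\times V\to D$, $\succ_V,\prec_V:V\times V\to V$. It is a dendriform extending structure if $D\times V$ with $(a,x)\succeq(b,y):=(a\succ b+a\leftharpoonup_1 y+x\rightharpoonup_1 b+f_1(x,y),\ a\triangleright_1 y+x\triangleleft_1 b+x\succ_V y)$ and $(a,x)\preceq(b,y):=(a\prec b+a\leftharpoonup_2 y+x\rightharpoonup_2 b+f_2(x,y),\ a\triangleright_2 y+x\triangleleft_2 b+x\prec_V y)$ is a dendriform algebra. $\mathcal{O}(D,V)$ is the set of all dendriform extending structures of $D$ through $V$. A flag datum of $D$ is a 12-tuple $(l_1,l_2,r_1,r_2,p_1,p_2,q_1,q_2,a_1,a_2,\bar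 k_1,\bar k_2)$ of linear maps $l_1,l_2,r_1,r_2:D\to\mathbf{k}$, $p_1,p_2,q_1,q_2:D\to D$, elements $a_1,a_2\in D$ and scalars $\bar k_1,\bar k_2\in\mathbf{k}$ such that for all $a,b\in D$ the following hold; $\mathcal{F}(D)$ denotes the set of all flag datums. (F1) $l_1(a\star b)=l_1(a)l_1(b)$; $l_2(a\prec b)=l_2(a)(l_1(b)+l_2(b))$; $l_2(a\succ b)=l_1(a)l_2(b)$; $(r_1(a)+r_2(a))r_1(b)=r_1(a\succ b)$; $r_2(a)r_2(b)=r_2(a\star b)$; $r_1(a)r_2(b)=r_1(a\prec b)$; $l_2(a)r_1(b)=0$. (F2) $q_1(a\star b)=a\succ q_1(b)+q_1(a)l_1(b)$; $q_2(a\prec b)=a\prec(q_1(b)+q_2(b))+q_2(a)(l_1(b)+l_2(b))$; $q_2(a\succ b)=a\succ q_2(b)+q_1(a)l_2(b)$. (F3) $(p_1(a)+p_2(a))\succ b+(r_1(a)+r_2(a))p_1(b)=p_1(a\succ b)$; $p_2(a)\prec b+r_2(a)p_2(b)=p_2(a\star b)$; $p_1(a)\prec b+r_1(a)p_2(b)=p_1(a\prec b)$. (F4) $(q_1(a)+q_2(a))\succ b+(l_1(a)+l_2(a))p_1(b)=a\succ p_1(b)+q_1(a)r_1(b)$; $q_2(a)\prec b+l_2(a)p_2(b)=a\prec(p_1(b)+p_2(b))+q_2(a)(r_1(b)+r_2(b))$; $q_1(a)\prec b+l_1(a)p_2(b)=a\succ p_2(b)+q_1(a)r_2(b)$. (F5)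 $(a_1+a_2)\succ a+(\bar k_1+\bar k_2)p_1(a)=p_1(p_1(a))+a_1r_1(a)$; $a_2\prec a+\bar k_2p_2(a)=p_2(p_1(a)+p_2(a))+a_2(r_1(a)+r_2(a))$; $a_1\prec a+\bar k_1p_2(a)=p_1(p_2(a))+a_1r_2(a)$. (F6) $\bar k_2r_1(a)=r_1(p_1(a))$; $r_2(p_1(a)+p_2(a))+\bar k_2r_1(a)=0$; $r_1(p_2(a))=0$. (F7) $q_1(q_1(a)+q_2(a))+a_1(l_1(a)+l_2(a))=a\succ a_1+q_1(a)\bar k_1$; $q_2(q_2(a))+a_2l_2(a)=a\prec(a_1+a_2)+q_2(a)(\bar k_1+\bar k_2)$; $q_2(q_1(a))+a_2l_1(a)=a\succ a_2+q_1(a)\bar k_2$. (F8) $l_1(q_1(a)+q_2(a))+l_2(a)\bar k_1=0$; $l_2(q_2(a))=l_2(a)\bar k_1$; $l_2(q_1(a))=0$. (F9) $q_1(p_1(a)+p_2(a))+a_1(r_1(a)+r_2(a))=p_1(q_1(a))+a_1l_1(a)$; $q_2(p_2(a))+a_2r_2(a)=p_2(q_1(a)+q_2(a))+a_2(l_1(a)+l_2(a))$; $q_2(p_1(a))+a_2r_1(a)=p_1(q_2(a))+a_1l_2(a)$. (F10) $l_1(p_1(a)+p_2(a))+(r_1(a)+r_2(a))\bar k_1=r_1(q_1(a))+\bar k_1l_1(a)$; $l_2(p_2(a))+r_2(a)\bar k_2=r_2(q_1(a)+q_2(a))+\bar k_2(l_1(a)+l_2(a))$; $l_2(p_1(a))+r_1(a)\bar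 k_2=r_1(q_2(a))+\bar k_1l_2(a)$. (F11) $q_1(a_1+a_2)+a_1\bar k_2=p_1(a_1)$; $q_2(a_2)=p_2(a_1+a_2)+a_2\bar k_1$; $q_2(a_1)+a_2\bar k_1=p_1(a_2)+a_1\bar k_2$. (F12) $l_1(a_1+a_2)+\bar k_2\bar k_1=r_1(a_1)$; $l_2(a_2)=r_2(a_1+a_2)+\bar k_2\bar k_1$; $l_2(a_1)=r_1(a_2)$. *)

(* Defs.v *)
From HB Require Import structures.
From mathcomp Require Import all_boot all_order all_algebra.
From mathcomp Require Import classical_sets functions reals.
From mathcomp Require Export complex.

Set Implicit Arguments.
Unset Strict Implicit.
Unset Printing Implicit Defensive.

Import GRing.Theory.

Local Open Scope ring_scope.
Local Open Scope classical_set_scope.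

Section Subspaces.
Variables (K : fieldType) (E : lmodType K).

Definition space_complement (SD SV : {pred E}) : Prop :=
  (forall e : E, exists d v : E, [/\ d \in SD, v \in SV & e = d + v]) /\
  (forall e : E, e \in SD -> e \in SV -> e = 0).

(* The class of some [v] is a basis of the quotient space [E / SD]. *)
Definition codim1 (SD : {pred E}) : Prop :=
  exists v : E,
    (forall c : K, c *: v \in SD -> c = 0) /\
    (forall e : E, exists c : K, e - c *: v \in SD).

Definition singleton_basis (x : E) : Prop :=
  (forall c : K, c *: x = 0 -> c = 0) /\
  (forall y : E, exists c : K, y = c *: x).

End Subspaces.

Definition is_dendriform (K : fieldType) (M : lmodType K)
    (succ prec : M -> M -> M) : Prop :=
  let star x y := succ x y + prec x y in
  [/\ bilinear_for *:%R *:%R succ /\ bilinear_for *:%R *:%R prec,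
      forall x y z, succ (star x y) z = succ x (succ y z),
      forall x y z, prec (prec x y) z = prec x (star y z)
    & forall x y z, prec (succ x y) z = succ x (prec y z)].

Section ExtendingStructures.
Variables (K : fieldType) (D V : lmodType K).

Record extending_datum := ExtendingDatum {
  ract1 : {bilinear D -> V -> V};   (* a |>_1 x *)
  ract2 : {bilinear D -> V -> V};   (* a |>_2 x *)
  lact1 : {bilinear V -> D -> V};   (* x <|_1 a *)
  lact2 : {bilinear V -> D -> V};   (* x <|_2 a *)
  rharp1 : {bilinear V -> D -> D};  (* x \rightharpoonup_1 a *)
  rharp2 : {bilinear V -> D -> D};  (* x \rightharpoonup_2 a *)
  lharp1 : {bilinear D -> V -> D};  (* a \leftharpoonup_1 x *)
  lharp2 : {bilinear D -> V -> D};  (* a \leftharpoonup_2 x *)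
  coc1 : {bilinear V -> V -> D};    (* f_1(x, y) *)
  coc2 : {bilinear V -> V -> D};    (* f_2(x, y) *)
  succV : {bilinear V -> V -> V};
  precV : {bilinear V -> V -> V}
}.

Variables succ prec : D -> D -> D.

Definition ext_succ (w : extending_datum) (u v : D * V) : D * V :=
  (succ u.1 v.1 + lharp1 w u.1 v.2 + rharp1 w u.2 v.1 + coc1 w u.2 v.2,
   ract1 w u.1 v.2 + lact1 w u.2 v.1 + succV w u.2 v.2).

Definition ext_prec (w : extending_datum) (u v : D * V) : D * V :=
  (prec u.1 v.1 + lharp2 w u.1 v.2 + rharp2 w u.2 v.1 + coc2 w u.2 v.2,
   ract2 w u.1 v.2 + lact2 w u.2 v.1 + precV w u.2 v.2).

Definition extending_structures : set extending_datum :=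
  [set w | is_dendriform (ext_succ w) (ext_prec w)].

End ExtendingStructures.

Section FlagData.
Variables (K : fieldType) (D : lmodType K).

Record flag_tuple := FlagTuple {
  fl1 : {scalar D}; fl2 : {scalar D};
  fr1 : {scalar D}; fr2 : {scalar D};
  fp1 : {linear D -> D}; fp2 : {linear D -> D};
  fq1 : {linear D -> D}; fq2 : {linear D -> D};
  fa1 : D; fa2 : D;
  fk1 : K; fk2 : K
}.

Variables succ prec : D -> D -> D.

Local Notation "x ≻ y" := (succ x y) (at level 40, left associativity).
Local Notation "x ≺ y" := (prec x y) (at level 40, left associativity).
Local Notation "x ⋆ y" := (x ≻ y + x ≺ y) (at level 40, left associativity).

(* Each equation is a component, along [D] or along [x], of one of the three
   dendriform axioms of the extended products on [D + K x], evaluated at the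
   triple indicated, after cancelling the terms common to both sides. *)
Definition flag_axioms (w : flag_tuple) (a b : D) : Prop :=
  let: FlagTuple l1 l2 r1 r2 p1 p2 q1 q2 a1 a2 k1 k2 := w in
  (* x-components of the axioms at (a, b, x), (x, a, b) and (a, x, b) *)
  (l1 (a ⋆ b) = l1 a * l1 b /\
   l2 (a ≺ b) = l2 a * (l1 b + l2 b) /\
   l2 (a ≻ b) = l1 a * l2 b /\
   (r1 a + r2 a) * r1 b = r1 (a ≻ b) /\
   r2 a * r2 b = r2 (a ⋆ b) /\
   r1 a * r2 b = r1 (a ≺ b) /\
   l2 a * r1 b = 0) /\
  (* D-components at (a, b, x) *)
  (q1 (a ⋆ b) = a ≻ q1 b + l1 b *: q1 a /\
   q2 (a ≺ b) = a ≺ (q1 b + q2 b) + (l1 b + l2 b) *: q2 a /\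
   q2 (a ≻ b) = a ≻ q2 b + l2 b *: q1 a) /\
  (* D-components at (x, a, b) *)
  ((p1 a + p2 a) ≻ b + (r1 a + r2 a) *: p1 b = p1 (a ≻ b) /\
   p2 a ≺ b + r2 a *: p2 b = p2 (a ⋆ b) /\
   p1 a ≺ b + r1 a *: p2 b = p1 (a ≺ b)) /\
  (* D-components at (a, x, b) *)
  ((q1 a + q2 a) ≻ b + (l1 a + l2 a) *: p1 b = a ≻ p1 b + r1 b *: q1 a /\
   q2 a ≺ b + l2 a *: p2 b = a ≺ (p1 b + p2 b) + (r1 b + r2 b) *: q2 a /\
   q1 a ≺ b + l1 a *: p2 b = a ≻ p2 b + r2 b *: q1 a) /\
  (* D-components at (x, x, a) *)
  ((a1 + a2) ≻ a + (k1 + k2) *: p1 a = p1 (p1 a) + r1 a *: a1 /\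
   a2 ≺ a + k2 *: p2 a = p2 (p1 a + p2 a) + (r1 a + r2 a) *: a2 /\
   a1 ≺ a + k1 *: p2 a = p1 (p2 a) + r2 a *: a1) /\
  (* x-components at (x, x, a) *)
  (k2 * r1 a = r1 (p1 a) /\
   r2 (p1 a + p2 a) + k2 * r1 a = 0 /\
   r1 (p2 a) = 0) /\
  (* D-components at (a, x, x) *)
  (q1 (q1 a + q2 a) + (l1 a + l2 a) *: a1 = a ≻ a1 + k1 *: q1 a /\
   q2 (q2 a) + l2 a *: a2 = a ≺ (a1 + a2) + (k1 + k2) *: q2 a /\
   q2 (q1 a) + l1 a *: a2 = a ≻ a2 + k2 *: q1 a) /\
  (* x-components at (a, x, x) *)
  (l1 (q1 a + q2 a) + l2 a * k1 = 0 /\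
   l2 (q2 a) = l2 a * k1 /\
   l2 (q1 a) = 0) /\
  (* D-components at (x, a, x) *)
  (q1 (p1 a + p2 a) + (r1 a + r2 a) *: a1 = p1 (q1 a) + l1 a *: a1 /\
   q2 (p2 a) + r2 a *: a2 = p2 (q1 a + q2 a) + (l1 a + l2 a) *: a2 /\
   q2 (p1 a) + r1 a *: a2 = p1 (q2 a) + l2 a *: a1) /\
  (* x-components at (x, a, x) *)
  (l1 (p1 a + p2 a) + (r1 a + r2 a) * k1 = r1 (q1 a) + k1 * l1 a /\
   l2 (p2 a) + r2 a * k2 = r2 (q1 a + q2 a) + k2 * (l1 a + l2 a) /\
   l2 (p1 a) + r1 a * k2 = r1 (q2 a) + k1 * l2 a) /\
  (* D-components at (x, x, x) *)
  (q1 (a1 + a2) + k2 *: a1 = p1 a1 /\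
   q2 a2 = p2 (a1 + a2) + k1 *: a2 /\
   q2 a1 + k1 *: a2 = p1 a2 + k2 *: a1) /\
  (* x-components at (x, x, x) *)
  (l1 (a1 + a2) + k2 * k1 = r1 a1 /\
   l2 a2 = r2 (a1 + a2) + k2 * k1 /\
   l2 a1 = r1 a2).

Definition flag_data : set flag_tuple :=
  [set w | forall a b : D, flag_axioms w a b].

End FlagData.

Section FlagExtending.
Variables (K : fieldType) (D V : lmodType K).

Definition flag_extending (x : V) (t : flag_tuple D)
    (w : extending_datum D V) : Prop :=
  (forall a : D,
     [/\ ract1 w a x = fl1 t a *: x /\ ract2 w a x = fl2 t a *: x,
         lact1 w x a = fr1 t a *: x /\ lact2 w x a = fr2 t a *: x,
         rharp1 w x a = fp1 t a /\ rharp2 w x a = fp2 t a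
       & lharp1 w a x = fq1 t a /\ lharp2 w a x = fq2 t a]) /\
  [/\ coc1 w x x = fa1 t, coc2 w x x = fa2 t,
      succV w x x = fk1 t *: x & precV w x x = fk2 t *: x].

End FlagExtending.

(* Main.v *)
Require Import Defs.
From HB Require Import structures.
From mathcomp Require Import all_boot all_order all_algebra.
From mathcomp Require Import classical_sets functions reals.
From mathcomp Require Import complex.
From mathcomp Require Import boolp ring.

(** Write the product space as [D + K x].  Since every vector of [V] is a
    scalar multiple of [x], a bilinear map with one or two arguments in [V] is
    determined by its values at [x], and these values may be prescribed freely:
    twelve bilinear maps amount to the four scalar functions, four
    endomorphisms, two vectors and two scalars of a flag tuple.  So the relation
    [flag_extending x] is the graph of a bijection between all flag tuples and
    all extending data, before any axiom is imposed
    ([flag_extending_total], [flag_extending_functional],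
    [flag_extending_surj], [flag_extending_inj]).

    What remains is that corresponding objects satisfy corresponding axioms
    ([flag_data_extending]).  Both sides of each dendriform identity are
    trilinear, so the identities hold on [D + K x] as soon as they hold on
    triples whose entries are elements of [D] or [x]
    ([is_dendriform_generated]).  Triples inside [D] give the axioms of [D]
    itself.  The seven other kinds of triples give one equation in [D] and one
    scalar equation for each of the three identities; after cancellation of
    common terms these are the flag axioms ([flag_axioms_ext_at]). *)

Set Implicit Arguments.
Unset Strict Implicit.
Unset Printing Implicit Defensive.

Import GRing.Theory.

Local Open Scope ring_scope.

(** * Linear and bilinear maps as functions *)

(** The algebraic part of a bundled map is a proof, so it is irrelevant to
    equality. *)
Lemma linear_ext (K : nzRingType) (U : lmodType K) (V : zmodType)
    (s : K -> V -> V) (f g : {linear U -> V | s}) : f =1 g -> f = g.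
Proof.
case: f g => [f [[df] [sf]]] [g [[dg] [sg]]] /= /funext fg.
move: df sf dg sg; rewrite {}fg => df sf dg sg.
by rewrite (Prop_irrelevance df dg) (Prop_irrelevance sf sg).
Qed.

Lemma bilinear_ext (K : nzRingType) (U V W : lmodType K)
    (f g : {bilinear U -> V -> W}) : f =2 g -> f = g.
Proof.
case: f g => [f [[lf rf zlf zrf]]] [g [[lg rg zlg zrg]]] /= fg.
have {}fg : f = g by apply/funext => u; apply/funext => v; apply: fg.
move: lf rf zlf zrf lg rg zlg zrg; rewrite {}fg => lf rf zlf zrf lg rg zlg zrg.
by rewrite (Prop_irrelevance lf lg) (Prop_irrelevance rf rg)
  (Prop_irrelevance zlf zlg) (Prop_irrelevance zrf zrg).
Qed.

Lemma linear_pack (K : nzRingType) (U : lmodType K) (V : zmodType)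
    (s : GRing.Scale.law K V) (h : U -> V) :
  GRing.linear_for s h -> {f : {linear U -> V | s} | f =1 h}.
Proof.
move=> hlin; pose m := GRing.isLinear.Build K U V s h hlin.
pose f : {linear U -> V | s} := HB.pack h m.
by exists f.
Qed.

Lemma bilinear_pack (K : nzRingType) (U V W : lmodType K) (h : U -> V -> W) :
  bilinear_for *:%R *:%R h -> {f : {bilinear U -> V -> W} | f =2 h}.
Proof.
move=> hbil; pose m := bilinear_isBilinear.Build K U V W *:%R *:%R h hbil.
pose f : {bilinear U -> V -> W} := HB.pack h m.
by exists f.
Qed.

(** This form and the next one cover all twelve maps of an extending datum
    when [V] is a line: the scalar factor is either one of [l_i], [r_i], or the
    coordinate of a vector of [V]. *)
Lemma scalar_linear_bilinear (K : comNzRingType) (U U' W : lmodType K)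
    (g : {scalar U}) (h : U' -> W) :
  linear h -> {f : {bilinear U -> U' -> W} | forall u v, f u v = g u *: h v}.
Proof.
move=> hlin; apply: bilinear_pack; split=> [v|u] c y z /=.
  by rewrite linearP scalerDl scalerA.
by rewrite hlin scalerDr !scalerA mulrC.
Qed.

Lemma linear_scalar_bilinear (K : comNzRingType) (U U' W : lmodType K)
    (g : {scalar U}) (h : U' -> W) :
  linear h -> {f : {bilinear U' -> U -> W} | forall v u, f v u = g u *: h v}.
Proof.
move=> hlin; apply: bilinear_pack; split=> [u|v] c y z /=.
  by rewrite hlin scalerDr !scalerA mulrC.
by rewrite linearP scalerDl scalerA.
Qed.

Lemma bilinear_for0 (K : nzRingType) (U U' W : lmodType K)
    (h : U -> U' -> W) :
  bilinear_for *:%R *:%R h -> (forall u, h 0 u = 0) * (forall u, h u 0 = 0).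
Proof.
move=> [hl hr]; split=> u.
  by have := hl u (-1) 0 0; rewrite /= scaler0 addr0 scaleN1r addNr.
by have := hr u (-1) 0 0; rewrite /= scaler0 addr0 scaleN1r addNr.
Qed.

Lemma scaler_addrACA (K : nzRingType) (W : lmodType K) (c : K)
    (a b a' b' : W) :
  (c *: a + b) + (c *: a' + b') = c *: (a + a') + (b + b').
Proof. by rewrite scalerDr addrACA. Qed.

(** * Flag tuples correspond to extending data *)

Section Correspondence.
Variables (K : fieldType) (D V : lmodType K) (x : V).
Hypothesis hx : singleton_basis x.

Lemma basis_scale_inj : injective ( *:%R^~ x : K -> V).
Proof.
move=> c d /eqP; rewrite -subr_eq0 -scalerBl => /eqP/hx.1/eqP.
by rewrite subr_eq0 => /eqP.
Qed.

Lemma coordinate_exists : {coord : {scalar V} | forall y, y = coord y *: x}.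
Proof.
pose h y := sval (cid (hx.2 y)).
have hE y : y = h y *: x by rewrite /h; case: cid.
have hs : scalar h.
  by move=> c u v; apply: basis_scale_inj; rewrite /= scalerDl -scalerA -!hE.
by have [f fE] := linear_pack hs; exists f => y; rewrite fE.
Qed.

Lemma flag_extending_inj (t t' : flag_tuple D) (w : extending_datum D V) :
  flag_extending x t w -> flag_extending x t' w -> t = t'.
Proof.
case: t t' => l1 l2 r1 r2 p1 p2 q1 q2 a1 a2 k1 k2.
case=> l1' l2' r1' r2' p1' p2' q1' q2' a1' a2' k1' k2'.
rewrite /flag_extending /=.
move=> [ht [<- <- k1E k2E]] [ht' [<- <-]].
rewrite k1E k2E => /basis_scale_inj -> /basis_scale_inj ->.
congr FlagTuple; apply: linear_ext => a.
all: have [[l1E l2E] [r1E r2E] [p1E p2E] [q1E q2E]] := ht a.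
all: have [[l1E' l2E'] [r1E' r2E'] [p1E' p2E'] [q1E' q2E']] := ht' a.
all: try apply: basis_scale_inj => /=.
all: by rewrite -?l1E' -?l2E' -?r1E' -?r2E' -?p1E' -?p2E' -?q1E' -?q2E'.
Qed.

Lemma flag_extending_functional (t : flag_tuple D)
    (w w' : extending_datum D V) :
  flag_extending x t w -> flag_extending x t w' -> w = w'.
Proof.
case: w w' => L1 L2 R1 R2 P1 P2 Q1 Q2 f1 f2 s1 s2.
case=> L1' L2' R1' R2' P1' P2' Q1' Q2' f1' f2' s1' s2'.
rewrite /flag_extending /=.
move=> [ht [f1E f2E s1E s2E]] [ht' [f1E' f2E' s1E' s2E']].
have act_eq a : (L1 a x = L1' a x) * (L2 a x = L2' a x) *
    ((R1 x a = R1' x a) * (R2 x a = R2' x a)) *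
    ((P1 x a = P1' x a) * (P2 x a = P2' x a)) *
    ((Q1 a x = Q1' a x) * (Q2 a x = Q2' a x)).
  have [[-> ->] [-> ->] [-> ->] [-> ->]] := ht a.
  by have [[-> ->] [-> ->] [-> ->] [-> ->]] := ht' a.
congr ExtendingDatum; apply: bilinear_ext => u v.
(* Each argument in [V] is replaced by a multiple of [x]. *)
all: try have [c ->] := hx.2 u.
all: try have [d ->] := hx.2 v.
all: rewrite ?linearZl_LR ?linearZr_LR /=.
all: by rewrite ?act_eq ?f1E ?f2E ?s1E ?s2E ?f1E' ?f2E' ?s1E' ?s2E'.
Qed.

Lemma flag_extending_total (t : flag_tuple D) :
  exists w : extending_datum D V, flag_extending x t w.
Proof.
have [coord coordE] := coordinate_exists.
have coordx : coord x = 1.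
  by apply: basis_scale_inj; rewrite /= -coordE scale1r.
have lin_id : linear (@id V) by [].
have lin_line (W : lmodType K) (w : W) : linear (fun y => coord y *: w).
  by move=> c y z; rewrite linearP scalerDl scalerA.
case: t => l1 l2 r1 r2 p1 p2 q1 q2 a1 a2 k1 k2.
have [L1 L1E] := scalar_linear_bilinear l1 lin_id.
have [L2 L2E] := scalar_linear_bilinear l2 lin_id.
have [R1 R1E] := linear_scalar_bilinear r1 lin_id.
have [R2 R2E] := linear_scalar_bilinear r2 lin_id.
have [P1 P1E] := scalar_linear_bilinear coord (linearP p1).
have [P2 P2E] := scalar_linear_bilinear coord (linearP p2).
have [Q1 Q1E] := linear_scalar_bilinear coord (linearP q1).
have [Q2 Q2E] := linear_scalar_bilinear coord (linearP q2).
have [f1 f1E] := scalar_linear_bilinear coord (lin_line _ a1).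
have [f2 f2E] := scalar_linear_bilinear coord (lin_line _ a2).
have [s1 s1E] := scalar_linear_bilinear coord (lin_line _ (k1 *: x)).
have [s2 s2E] := scalar_linear_bilinear coord (lin_line _ (k2 *: x)).
exists (ExtendingDatum L1 L2 R1 R2 P1 P2 Q1 Q2 f1 f2 s1 s2).
split=> [a|]; split=> /=; try split.
all: by rewrite ?L1E ?L2E ?R1E ?R2E ?P1E ?P2E ?Q1E ?Q2E ?f1E ?f2E ?s1E ?s2E
  ?coordx ?scale1r.
Qed.

Lemma flag_extending_surj (w : extending_datum D V) :
  exists t : flag_tuple D, flag_extending x t w.
Proof.
have [coord coordE] := coordinate_exists.
have coordP (L : D -> V) : linear L -> scalar (coord \o L).
  by move=> hL c u v; rewrite /= hL linearP.
have [l1 l1E] := linear_pack (coordP _ (linearPl (ract1 w) x)).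
have [l2 l2E] := linear_pack (coordP _ (linearPl (ract2 w) x)).
have [r1 r1E] := linear_pack (coordP _ (linearPr (lact1 w) x)).
have [r2 r2E] := linear_pack (coordP _ (linearPr (lact2 w) x)).
have [p1 p1E] := linear_pack (linearPr (rharp1 w) x).
have [p2 p2E] := linear_pack (linearPr (rharp2 w) x).
have [q1 q1E] := linear_pack (linearPl (lharp1 w) x).
have [q2 q2E] := linear_pack (linearPl (lharp2 w) x).
exists (FlagTuple l1 l2 r1 r2 p1 p2 q1 q2 (coc1 w x x) (coc2 w x x)
  (coord (succV w x x)) (coord (precV w x x))).
split=> [a|]; split=> /=; try split.
all: by rewrite ?l1E ?l2E ?r1E ?r2E ?p1E ?p2E ?q1E ?q2E /= -?coordE.
Qed.

End Correspondence.

(** * Dendriform identities on generators *)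

Definition trilinear (K : nzRingType) (M N : lmodType K)
    (S : M -> M -> M -> N) : Prop :=
  [/\ forall v w, linear (fun u => S u v w),
      forall u w, linear (fun v => S u v w)
    & forall u v, linear (fun w => S u v w)].

(** Each argument is a combination [c *: g + h] of two elements of [G], so both
    sides expand to the same combination of values on [G]. *)
Lemma trilinear_eq (K : nzRingType) (M N : lmodType K) (G : M -> Prop)
    (S T : M -> M -> M -> N) :
  (forall u, exists c g h, [/\ G g, G h & u = c *: g + h]) ->
  trilinear S -> trilinear T ->
  (forall u v w, G u -> G v -> G w -> S u v w = T u v w) ->
  forall u v w, S u v w = T u v w.
Proof.
move=> genG [S1 S2 S3] [T1 T2 T3] eqG u v w.
have [c [g [h [Gg Gh ->]]]] := genG u.
have [c' [g' [h' [Gg' Gh' ->]]]] := genG v.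
have [c'' [g'' [h'' [Gg'' Gh'' ->]]]] := genG w.
by rewrite !S1 !T1 !S2 !T2 !S3 !T3 !eqG.
Qed.

Definition dendriform_at (K : fieldType) (M : lmodType K)
    (succ prec : M -> M -> M) (u v w : M) : Prop :=
  [/\ succ (succ u v + prec u v) w = succ u (succ v w),
      prec (prec u v) w = prec u (succ v w + prec v w)
    & prec (succ u v) w = succ u (prec v w)].

Lemma is_dendriform_generated (K : fieldType) (M : lmodType K)
    (G : M -> Prop) (succ prec : M -> M -> M) :
  bilinear_for *:%R *:%R succ -> bilinear_for *:%R *:%R prec ->
  (forall u, exists c g h, [/\ G g, G h & u = c *: g + h]) ->
  is_dendriform succ prec <->
    (forall u v w, G u -> G v -> G w -> dendriform_at succ prec u v w).
Proof.
move=> succ_bil prec_bil genG.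
split=> [[_ ax1 ax2 ax3] u v w _ _ _ | axG]; first by split.
have [succl succr] := succ_bil; have [precl precr] := prec_bil.
have lin := (succl, succr, precl, precr, scaler_addrACA).
split=> //.
- apply: (@trilinear_eq K M M G (fun u v w => succ (succ u v + prec u v) w)
    (fun u v w => succ u (succ v w)) genG) => [||u v w Gu Gv Gw].
  + by split=> ? ? c y z /=; rewrite ?lin.
  + by split=> ? ? c y z /=; rewrite ?lin.
  + by case: (axG u v w).
- apply: (@trilinear_eq K M M G (fun u v w => prec (prec u v) w)
    (fun u v w => prec u (succ v w + prec v w)) genG) => [||u v w Gu Gv Gw].
  + by split=> ? ? c y z /=; rewrite ?lin.
  + by split=> ? ? c y z /=; rewrite ?lin.
  + by case: (axG u v w).
- apply: (@trilinear_eq K M M G (fun u v w => prec (succ u v) w)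
    (fun u v w => succ u (prec v w)) genG) => [||u v w Gu Gv Gw].
  + by split=> ? ? c y z /=; rewrite ?lin.
  + by split=> ? ? c y z /=; rewrite ?lin.
  + by case: (axG u v w).
Qed.

Lemma ext_succ_bilinear (K : fieldType) (D V : lmodType K)
    (succ : D -> D -> D) (w : extending_datum D V) :
  bilinear_for *:%R *:%R succ -> bilinear_for *:%R *:%R (ext_succ succ w).
Proof.
move=> [succl succr]; split=> z c u v; rewrite /ext_succ /= (succl, succr).
  by rewrite !linearPl !scaler_addrACA.
by rewrite !linearPr !scaler_addrACA.
Qed.

Lemma ext_prec_bilinear (K : fieldType) (D V : lmodType K)
    (prec : D -> D -> D) (w : extending_datum D V) :
  bilinear_for *:%R *:%R prec -> bilinear_for *:%R *:%R (ext_prec prec w).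
Proof.
move=> [precl precr]; split=> z c u v; rewrite /ext_prec /= (precl, precr).
  by rewrite !linearPl !scaler_addrACA.
by rewrite !linearPr !scaler_addrACA.
Qed.

(** * Dendriform identities and flag axioms *)

Lemma cancel_scaler_l (K : nzRingType) (M : lmodType K) (k l : K) (a u v : M) :
  (u + (k + l) *: a = v + k *: a) = (u + l *: a = v).
Proof.
rewrite scalerDl [k *: a + _]addrC addrA.
by apply/propext; split=> [/addIr|->].
Qed.

Lemma cancel_scaler_r (K : nzRingType) (M : lmodType K) (k l : K) (a u v : M) :
  (u + l *: a = v + (k + l) *: a) = (u = v + k *: a).
Proof. by rewrite scalerDl addrA; apply/propext; split=> [/addIr|->]. Qed.

(** Reduces the passage between an equation and its cancelled form to a ring
    identity. *)
Lemma eq_of_eq_sub (M : zmodType) (a b c d : M) :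
  c = d -> a - b = c - d -> a = b.
Proof. by move=> -> /eqP; rewrite subrr subr_eq0 => /eqP. Qed.

Section FlagAxioms.
Variables (K : fieldType) (D V : lmodType K) (x : V).
Hypothesis hx : singleton_basis x.
Variables (succ prec : D -> D -> D).
Hypothesis hD : is_dendriform succ prec.
Variables (t : flag_tuple D) (w : extending_datum D V).
Hypothesis htw : flag_extending x t w.

Local Notation l1 := (fl1 t).
Local Notation l2 := (fl2 t).
Local Notation r1 := (fr1 t).
Local Notation r2 := (fr2 t).
Local Notation p1 := (fp1 t).
Local Notation p2 := (fp2 t).
Local Notation q1 := (fq1 t).
Local Notation q2 := (fq2 t).
Local Notation a1 := (fa1 t).
Local Notation a2 := (fa2 t).
Local Notation k1 := (fk1 t).
Local Notation k2 := (fk2 t).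
Local Notation "u ≻ v" := (succ u v) (at level 40, left associativity).
Local Notation "u ≺ v" := (prec u v) (at level 40, left associativity).

(** Products are computed in the coordinates [D * K], in which an equation
    splits into a [D]-component and a scalar one. *)
Definition line_pair (a : D) (c : K) : D * V := (a, c *: x).

Lemma line_pairD a b c d :
  line_pair a c + line_pair b d = line_pair (a + b) (c + d).
Proof. by rewrite /line_pair scalerDl. Qed.

Lemma line_pair_eq a b c d :
  (line_pair a c = line_pair b d) = (a = b /\ c = d).
Proof.
by apply/propext; split=> [[-> /(basis_scale_inj hx) ->]|[-> ->]].
Qed.

Lemma ext_succ_line_pair a b c d :
  ext_succ succ w (line_pair a c) (line_pair b d) =
  line_pair (a ≻ b + d *: q1 a + c *: p1 b + (c * d) *: a1)
            (d * l1 a + c * r1 b + c * d * k1).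
Proof.
have [act [coc1E _ succE _]] := htw.
have [[lE _] _ _ [qE _]] := act a; have [_ [rE _] [pE _] _] := act b.
rewrite /ext_succ /line_pair /= !linearZl_LR !linearZr_LR /= !scalerDl.
by rewrite lE qE rE pE coc1E succE !scalerA.
Qed.

Lemma ext_prec_line_pair a b c d :
  ext_prec prec w (line_pair a c) (line_pair b d) =
  line_pair (a ≺ b + d *: q2 a + c *: p2 b + (c * d) *: a2)
            (d * l2 a + c * r2 b + c * d * k2).
Proof.
have [act [_ coc2E _ precE]] := htw.
have [[_ lE] _ _ [_ qE]] := act a; have [_ [_ rE] [_ pE] _] := act b.
rewrite /ext_prec /line_pair /= !linearZl_LR !linearZr_LR /= !scalerDl.
by rewrite lE qE rE pE coc2E precE !scalerA.
Qed.

Local Notation inD a := (line_pair a 0).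
Local Notation xV := (line_pair 0 1).
Local Notation ext_at := (dendriform_at (ext_succ succ w) (ext_prec prec w)).

Let linear00 := (linear0 l1, linear0 l2, linear0 r1, linear0 r2,
  linear0 p1, linear0 p2, linear0 q1, linear0 q2).

(** Products in which at least one factor is a generator: these are all that
    occur in the dendriform identities at generators.  As a rewriting rule, the
    products of two generators come first, since they are instances of the
    others. *)
Lemma ext_succ_generators :
  (forall a b, ext_succ succ w (inD a) (inD b) = inD (a ≻ b)) *
  (forall a, ext_succ succ w (inD a) xV = line_pair (q1 a) (l1 a)) *
  (forall a, ext_succ succ w xV (inD a) = line_pair (p1 a) (r1 a)) *
  (ext_succ succ w xV xV = line_pair a1 k1) *
  (forall a c b, ext_succ succ w (line_pair a c) (inD b) =
     line_pair (a ≻ b + c *: p1 b) (c * r1 b)) *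
  (forall a c, ext_succ succ w (line_pair a c) xV =
     line_pair (q1 a + c *: a1) (l1 a + c * k1)) *
  (forall a b d, ext_succ succ w (inD a) (line_pair b d) =
     line_pair (a ≻ b + d *: q1 a) (d * l1 a)) *
  (forall b d, ext_succ succ w xV (line_pair b d) =
     line_pair (p1 b + d *: a1) (r1 b + d * k1)).
Proof.
have [[succ_bil _] _ _ _] := hD; have succ0 := bilinear_for0 succ_bil.
have simp := (linear00, succ0, mul0r, mulr0, mul1r, mulr1,
  scale0r, scaler0, scale1r, add0r, addr0).
by do !split=> *; rewrite ext_succ_line_pair !simp.
Qed.

Lemma ext_prec_generators :
  (forall a b, ext_prec prec w (inD a) (inD b) = inD (a ≺ b)) *
  (forall a, ext_prec prec w (inD a) xV = line_pair (q2 a) (l2 a)) *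
  (forall a, ext_prec prec w xV (inD a) = line_pair (p2 a) (r2 a)) *
  (ext_prec prec w xV xV = line_pair a2 k2) *
  (forall a c b, ext_prec prec w (line_pair a c) (inD b) =
     line_pair (a ≺ b + c *: p2 b) (c * r2 b)) *
  (forall a c, ext_prec prec w (line_pair a c) xV =
     line_pair (q2 a + c *: a2) (l2 a + c * k2)) *
  (forall a b d, ext_prec prec w (inD a) (line_pair b d) =
     line_pair (a ≺ b + d *: q2 a) (d * l2 a)) *
  (forall b d, ext_prec prec w xV (line_pair b d) =
     line_pair (p2 b + d *: a2) (r2 b + d * k2)).
Proof.
have [[_ prec_bil] _ _ _] := hD; have prec0 := bilinear_for0 prec_bil.
have simp := (linear00, prec0, mul0r, mulr0, mul1r, mulr1,
  scale0r, scaler0, scale1r, add0r, addr0).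
by do !split=> *; rewrite ext_prec_line_pair !simp.
Qed.

Local Ltac expand_identities :=
  rewrite /dendriform_at !(ext_succ_generators, ext_prec_generators);
  rewrite !line_pairD !(ext_succ_generators, ext_prec_generators);
  rewrite ?addr0 ?scale0r ?mul0r ?addr0 !line_pair_eq
    ?cancel_scaler_l ?cancel_scaler_r.

(* A scalar equation follows from its cancelled form, or conversely, by
   comparing the differences of their sides; the sign is not known ahead. *)
Local Ltac compare_components :=
  apply/propext; split; let ax := fresh "ax" in
  move=> ax; decompose [and and3] ax; do !split=> //;
  first
    [ by ring
    | match goal with H : _ = _ |- _ =>
        by apply: (eq_of_eq_sub H); ring end
    | match goal with H : _ = _ |- _ =>
        by apply: (eq_of_eq_sub (esym H)); ring end ].

Lemma ext_at_DDD a b c : ext_at (inD a) (inD b) (inD c).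
Proof.
have [_ ax1 ax2 ax3] := hD.
by expand_identities; rewrite ax1 ax2 ax3.
Qed.

Lemma ext_at_DDx a b :
  ext_at (inD a) (inD b) xV =
  ([/\ q1 (a ≻ b + a ≺ b) = a ≻ q1 b + l1 b *: q1 a,
       q2 (a ≺ b) = a ≺ (q1 b + q2 b) + (l1 b + l2 b) *: q2 a
     & q2 (a ≻ b) = a ≻ q2 b + l2 b *: q1 a] /\
   [/\ l1 (a ≻ b + a ≺ b) = l1 a * l1 b,
       l2 (a ≺ b) = l2 a * (l1 b + l2 b)
     & l2 (a ≻ b) = l1 a * l2 b]).
Proof. expand_identities; compare_components. Qed.

Lemma ext_at_xDD a b :
  ext_at xV (inD a) (inD b) =
  ([/\ (p1 a + p2 a) ≻ b + (r1 a + r2 a) *: p1 b = p1 (a ≻ b),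
       p2 a ≺ b + r2 a *: p2 b = p2 (a ≻ b + a ≺ b)
     & p1 a ≺ b + r1 a *: p2 b = p1 (a ≺ b)] /\
   [/\ (r1 a + r2 a) * r1 b = r1 (a ≻ b),
       r2 a * r2 b = r2 (a ≻ b + a ≺ b)
     & r1 a * r2 b = r1 (a ≺ b)]).
Proof. expand_identities; compare_components. Qed.

(** The scalar component of the first identity and that of the second are
    [l2 a * r1 b = 0]; that of the third is trivial. *)
Lemma ext_at_DxD a b :
  ext_at (inD a) xV (inD b) =
  ([/\ (q1 a + q2 a) ≻ b + (l1 a + l2 a) *: p1 b = a ≻ p1 b + r1 b *: q1 a,
       q2 a ≺ b + l2 a *: p2 b =
         a ≺ (p1 b + p2 b) + (r1 b + r2 b) *: q2 a
     & q1 a ≺ b + l1 a *: p2 b = a ≻ p2 b + r2 b *: q1 a] /\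
   l2 a * r1 b = 0).
Proof. expand_identities; compare_components. Qed.

Lemma ext_at_xxD a :
  ext_at xV xV (inD a) =
  ([/\ (a1 + a2) ≻ a + (k1 + k2) *: p1 a = p1 (p1 a) + r1 a *: a1,
       a2 ≺ a + k2 *: p2 a = p2 (p1 a + p2 a) + (r1 a + r2 a) *: a2
     & a1 ≺ a + k1 *: p2 a = p1 (p2 a) + r2 a *: a1] /\
   [/\ k2 * r1 a = r1 (p1 a),
       r2 (p1 a + p2 a) + k2 * r1 a = 0
     & r1 (p2 a) = 0]).
Proof. expand_identities; compare_components. Qed.

Lemma ext_at_Dxx a :
  ext_at (inD a) xV xV =
  ([/\ q1 (q1 a + q2 a) + (l1 a + l2 a) *: a1 = a ≻ a1 + k1 *: q1 a,
       q2 (q2 a) + l2 a *: a2 = a ≺ (a1 + a2) + (k1 + k2) *: q2 a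
     & q2 (q1 a) + l1 a *: a2 = a ≻ a2 + k2 *: q1 a] /\
   [/\ l1 (q1 a + q2 a) + l2 a * k1 = 0,
       l2 (q2 a) = l2 a * k1
     & l2 (q1 a) = 0]).
Proof. expand_identities; compare_components. Qed.

Lemma ext_at_xDx a :
  ext_at xV (inD a) xV =
  ([/\ q1 (p1 a + p2 a) + (r1 a + r2 a) *: a1 = p1 (q1 a) + l1 a *: a1,
       q2 (p2 a) + r2 a *: a2 = p2 (q1 a + q2 a) + (l1 a + l2 a) *: a2
     & q2 (p1 a) + r1 a *: a2 = p1 (q2 a) + l2 a *: a1] /\
   [/\ l1 (p1 a + p2 a) + (r1 a + r2 a) * k1 = r1 (q1 a) + k1 * l1 a,
       l2 (p2 a) + r2 a * k2 = r2 (q1 a + q2 a) + k2 * (l1 a + l2 a)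
     & l2 (p1 a) + r1 a * k2 = r1 (q2 a) + k1 * l2 a]).
Proof. expand_identities; compare_components. Qed.

Lemma ext_at_xxx :
  ext_at xV xV xV =
  ([/\ q1 (a1 + a2) + k2 *: a1 = p1 a1,
       q2 a2 = p2 (a1 + a2) + k1 *: a2
     & q2 a1 + k1 *: a2 = p1 a2 + k2 *: a1] /\
   [/\ l1 (a1 + a2) + k2 * k1 = r1 a1,
       l2 a2 = r2 (a1 + a2) + k2 * k1
     & l2 a1 = r1 a2]).
Proof. expand_identities; compare_components. Qed.

Lemma flag_axioms_ext_at a b :
  flag_axioms succ prec t a b <->
    [/\ ext_at (inD a) (inD b) xV, ext_at xV (inD a) (inD b)
      & ext_at (inD a) xV (inD b)] /\
    [/\ ext_at xV xV (inD a), ext_at (inD a) xV xV, ext_at xV (inD a) xV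
      & ext_at xV xV xV].
Proof.
rewrite ext_at_DDx ext_at_xDD ext_at_DxD ext_at_xxD ext_at_Dxx ext_at_xDx.
rewrite ext_at_xxx /flag_axioms; case: t => *.
by split=> ax; decompose [and and3 and4] ax; do !split.
Qed.

Lemma is_dendriform_ext_at :
  is_dendriform (ext_succ succ w) (ext_prec prec w) <->
  forall a b : D,
    [/\ ext_at (inD a) (inD b) xV, ext_at xV (inD a) (inD b)
      & ext_at (inD a) xV (inD b)] /\
    [/\ ext_at xV xV (inD a), ext_at (inD a) xV xV, ext_at xV (inD a) xV
      & ext_at xV xV xV].
Proof.
pose G u := (exists a, u = inD a) \/ u = xV.
have [[succ_bil prec_bil] _ _ _] := hD.
rewrite (is_dendriform_generated (G := G)); [split|..].
- by move=> axG a b; split; split; apply: axG; by [right | left; eexists].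
- move=> axV u v z [[a ->]|->] [[b ->]|->] [[c ->]|->];
    [exact: ext_at_DDD|..];
    by [ have [[]] := axV a b | have [[]] := axV a c | have [[]] := axV b c
       | have [_ []] := axV a a | have [_ []] := axV b b
       | have [_ []] := axV c c | have [_ []] := axV 0 0 ].
- exact: ext_succ_bilinear.
- exact: ext_prec_bilinear.
- move=> [a y]; have [c ->] := hx.2 y.
  exists c, xV, (inD a); split; [by right | by left; exists a |].
  rewrite /line_pair /= scale0r scale1r.
  by congr (_, _); rewrite /= ?scaler0 ?add0r ?addr0.
Qed.

Lemma flag_data_extending :
  flag_data succ prec t <-> extending_structures succ prec w.
Proof.
apply: (iff_trans _ (iff_sym is_dendriform_ext_at)).
by split=> ax a b; apply/flag_axioms_ext_at.
Qed.

End FlagAxioms.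

(** * The bijection *)

Theorem theorem3p18 (R : realType) (E : lmodType R[i])
    (SD : {pred E}) (D : subLmodType SD) (succ prec : D -> D -> D)
    (hD : is_dendriform succ prec) (hcodim : codim1 SD)
    (SV : {pred E}) (V : subLmodType SV) (hV : space_complement SD SV)
    (x : V) (hx : singleton_basis x) :
  exists Phi : flag_tuple D -> extending_datum D V,
    set_bij (flag_data succ prec) (extending_structures succ prec) Phi /\
    forall t : flag_tuple D, flag_data succ prec t -> flag_extending x t (Phi t).
Proof.
have [Phi PhiP] := choice (flag_extending_total (D := D) hx).
exists Phi; split=> //; split=> [t ht|t t' _ _ eqPhi|w hw].
- exact/(flag_data_extending hx hD (PhiP t)).
- by apply: (flag_extending_inj hx _ (PhiP t')); rewrite -eqPhi; exact: PhiP.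
- have [t htw] := flag_extending_surj (D := D) hx w.
  exists t; first exact/(flag_data_extending hx hD htw).
  exact: (flag_extending_functional hx (PhiP t) htw).
Qed.
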